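(* Let $G$ be a hyper group, $H$ a sub hyper group of $G$ and $N$ a normal sub hyper group of $G$, with identity sets $\mathbf e_H$, $\mathbf e_N$. Then for each $e\in\mathbf e_H\cap\mathbf e_N$: (i) $N_e\cap H_e$ is a normal subgroup of $H_e$; (ii) $N_eH_e=\{nh: n\in N_e,h\in H_e\}$ is a subgroup of $G_e$; (iii) the map $\pi_e:H_e/(N_e\cap H_e)\to N_eH_e/N_e$, $h_e(N_e\cap H_e)\mapsto h_eN_e$ ($h_e\in H_e$), is an isomorphism; i.e. $H_e/(H_e\cap N_e)\cong N_eH_e/N_e$.
   Context: Hyper group: Let $(G,* )$ be a semigroup. A subset $\mathbf e\subset G$ is an identity set if (i) $g*e=e*g$ for all $g\in G$, $e\in\mathbf e$; (ii) $\mathbf e=\{e_\lambda:\lambda\in\Lambda\}$ is indexed without repetition by a lattice $(\Lambda,\le)$ and $e_\lambda*e_\mu=e_{\lambda\vee\mu}$; (iii) for each $g\in G$ there is a unique $e_g=e_{\lambda_g}\in\mathbf e$ such that for all $\lambda\in\Lambda$: $e_\lambda*g=g$ if and only if $\lambda\le\lambda_g$. A hyper group $(G,*,\mathbf e)$ is a semigroup with an identity set such that for each $g\in G$ there is $g^{-1}\in G$ with $g*g^{-1}=g^{-1}*g=e_g$. For $e\in\mathbf e$, the component group is $G_e=\{x\in G: e_x=e\}$, a group under $*$ with identity $e$. Sub hyper group of $(G,*,\mathbf e)$: a hyper group $(H,*,\mathbf e_H)$ with $H\subset G$ and $\mathbf e_H\subset\mathbf e$ a sublattice; $H_e=\{h\in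 H:e_h=e\}$ for $e\in\mathbf e_H$. It is normal if $gH_{e_g}=H_{e_g}g$ for all $g\in G$ with $e_g\in\mathbf e_H$. *)

(* Defs.v *)
From mathcomp Require Import all_boot all_order.
From mathcomp Require Import boolp classical_sets functions.

Set Implicit Arguments.
Unset Strict Implicit.
Unset Printing Implicit Defensive.

Local Open Scope classical_set_scope.
Local Open Scope group_scope.

(* Groups are taken as subsets [K] of a type rather than as [groupType]s: the
   component groups of one hyper group live in one semigroup but have distinct
   units, and quotients are sets of cosets. *)
Record is_group (T : Type) (op : T -> T -> T) (K : set T) (u : T) : Prop := {
  is_group_op : forall x y, K x -> K y -> K (op x y) ;
  is_group_assoc : forall x y z, K x -> K y -> K z ->
    op x (op y z) = op (op x y) z ;
  is_group_unit : K u ;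
  is_group_op1 : forall x, K x -> op u x = x /\ op x u = x ;
  is_group_inv : forall x, K x -> exists2 y, K y & op x y = u /\ op y x = u }.

Definition is_group_iso (T U : Type)
    (opT : T -> T -> T) (K : set T) (uK : T)
    (opU : U -> U -> U) (L : set U) (uL : U) (f : T -> U) : Prop :=
  [/\ is_group opT K uK, is_group opU L uL, set_bij K L f
    & forall x y, K x -> K y -> f (opT x y) = opU (f x) (f y)].

Section SubsetsOfSemigroup.
Variable G : semigroupType.
Implicit Types (A B K S : set G) (e g : G).

Definition set_mul A B : set G := [set a * b | a in A & b in B].
Definition left_coset g A : set G := [set g * a | a in A].
Definition right_coset A g : set G := [set a * g | a in A].

(* In [is_subgroup S K e] and [is_normal_subgroup S K e], [e] is the common
   unit of the group [K] and its subgroup [S]. *)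
Definition is_subgroup S K e : Prop :=
  [/\ is_group *%g K e, is_group *%g S e & S `<=` K].

Definition is_normal_subgroup S K e : Prop :=
  is_subgroup S K e /\ forall x, K x -> left_coset x S = right_coset S x.

(* The underlying set of the quotient K / S; its group law is [set_mul] and its
   unit is the coset [S]. *)
Definition cosets K S : set (set G) := [set left_coset x S | x in K].

End SubsetsOfSemigroup.

Section HyperGroup.
Variables (d : Order.disp_t) (L : latticeType d) (G : semigroupType).
Variable ix : L -> G.
Implicit Types (A E H : set G) (e g : G) (k l m : L).

(* Everything is relative to an indexing [ix] of identities by a lattice [L].
   A subset [E] of [range ix] is indexed by the set of all [l] with
   [E (ix l)], ordered as in [L].  The whole hyper group is the case
   [A = setT], [E = range ix], where all of [L] is the index lattice. *)

(* [e = e_g] in the hyper group with identity set [E]. *)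
Definition identity_of E g e : Prop :=
  E e /\ exists2 l, ix l = e &
    forall k, E (ix k) -> (ix k * g = g <-> (k <= l)%O).

Definition is_sublattice E : Prop :=
  E `<=` range ix /\
  forall l m, E (ix l) -> E (ix m) ->
    E (ix (Order.join l m)) /\ E (ix (Order.meet l m)).

Record is_identity_set A E : Prop := {
  identity_set_sub : E `<=` A ;
  identity_set_comm : forall g e, A g -> E e -> g * e = e * g ;
  identity_set_lattice : is_sublattice E ;
  identity_set_inj : forall l m, E (ix l) -> E (ix m) -> ix l = ix m -> l = m ;
  identity_set_join : forall l m, E (ix l) -> E (ix m) ->
    ix l * ix m = ix (Order.join l m) ;
  identity_set_of : forall g, A g -> exists! e, identity_of E g e }.

Record is_hyper_group_on A E : Prop := {
  hyper_group_mul : forall g h, A g -> A h -> A (g * h) ;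
  hyper_group_ids : is_identity_set A E ;
  hyper_group_inv : forall g, A g -> exists2 g', A g' &
    forall e, identity_of E g e -> g * g' = e /\ g' * g = e }.

Definition is_hyper_group : Prop := is_hyper_group_on setT (range ix).

(* For a hyper group [G] indexed by [ix]; [E `<=` range ix] and the closure of
   [E] under the operations of [L] are part of [is_identity_set]. *)
Definition is_sub_hyper_group H E : Prop := is_hyper_group_on H E.

Definition component A E e : set G := [set x | A x /\ identity_of E x e].

Definition is_normal_sub_hyper_group H E : Prop :=
  is_sub_hyper_group H E /\
  forall g e, identity_of (range ix) g e -> E e ->
    left_coset g (component H E e) = right_coset (component H E e) g.

End HyperGroup.

(* Main.v *)
Require Import Defs.
From mathcomp Require Import all_boot all_order.
From mathcomp Require Import boolp classical_sets functions.

(** Inside one component group the claim is the classical second isomorphism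
theorem, so two things have to be explained.

The components [H_e], [N_e] are defined by two different notions of identity
element, [e_h] being computed inside [H] or inside [N], whereas [G_e] uses the
one of [G].  They agree because membership in a component has a description
that does not mention the index lattice: [x] lies in the component of [e] as
soon as [e * x = x] and [x] has a right inverse with respect to [e]
([component_of_invertible]).  Indeed, [e_k * x = x] then gives [e_k * e = e]
after multiplication by this inverse, that is [k \/ l = l] for [e = e_l].
This criterion makes every component a group with unit [e]
([component_group]) and gives [H_e, N_e `<=` G_e] ([component_subgroup]).

It remains to prove the second isomorphism theorem for subsets [N], [H] of a
semigroup which are subgroups of a group [K], with [N] normal in [K]
([second_isomorphism]).  The map is [C |-> C N]: on a coset
[h (N `&` H)] it takes the value [h N], as [(N `&` H) N = N].  It respects
products because [x N * y N = x y N] ([left_coset_mul]); it is onto because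
[n h N = n N h = N h = h N]; and it is one-to-one because [h N = k N] forces
[k^-1 h] to lie in [N `&` H]. *)

Local Open Scope classical_set_scope.
Local Open Scope group_scope.

Import Order.LTheory.

Set Implicit Arguments.
Unset Strict Implicit.
Unset Printing Implicit Defensive.

(** * Products of subsets of a semigroup *)

Section SetProducts.
Variable G : semigroupType.
Implicit Types (A B C S T K N H : set G) (x y e : G).

Lemma set_mulA A B C : set_mul A (set_mul B C) = set_mul (set_mul A B) C.
Proof.
apply/seteqP; split=> z.
  move=> [a Aa] [_ [b Bb [c Cc <-]] <-]; exists (a * b).
    by exists a => //; exists b.
  by exists c => //; rewrite mulgA.
move=> [_ [a Aa [b Bb <-]] [c Cc <-]]; exists a => //.
by exists (b * c); [exists b => //; exists c | rewrite mulgA].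
Qed.

Lemma left_cosetE x S : left_coset x S = set_mul [set x] S.
Proof.
apply/seteqP; split=> z; first by move=> [s Ss <-]; exists x => //; exists s.
by move=> [_ -> [s Ss <-]]; exists s.
Qed.

Lemma right_cosetE x S : right_coset S x = set_mul S [set x].
Proof.
apply/seteqP; split=> z; first by move=> [s Ss <-]; exists s => //; exists x.
by move=> [s Ss [_ -> <-]]; exists s.
Qed.

Lemma left_coset_comp x y S :
  left_coset (x * y) S = left_coset x (left_coset y S).
Proof.
rewrite !left_cosetE set_mulA -(left_cosetE x [set y]).
by congr (set_mul _ _); rewrite /left_coset image_set1.
Qed.

(** Absorption: used both with [T = S], and with [T] a subgroup of [S] to
compute the image of a coset of [T]. *)
Lemma set_mul_absorb S T e :
  is_group *%g S e -> T e -> T `<=` S -> set_mul T S = S.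
Proof.
move=> gS Te TS; apply/seteqP; split=> z.
  by move=> [t Tt [s Ss <-]]; apply: (is_group_op gS) => //; exact: TS.
move=> Sz; exists e => //; exists z => //.
by case: (is_group_op1 gS Sz).
Qed.

Lemma left_coset_absorb S e x :
  is_group *%g S e -> S x -> left_coset x S = S.
Proof.
move=> gS Sx; apply/seteqP; split=> z.
  by move=> [s Ss <-]; apply: (is_group_op gS).
move=> Sz; have [y Sy [xy _]] := is_group_inv gS Sx.
exists (y * z); first exact: (is_group_op gS).
by rewrite mulgA xy; case: (is_group_op1 gS Sz).
Qed.

(** * Quotients by a normal subgroup *)

Lemma left_coset_mul S K e x y : is_normal_subgroup S K e -> K y ->
  set_mul (left_coset x S) (left_coset y S) = left_coset (x * y) S.
Proof.
move=> [[gK gS SK] nS] Ky.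
rewrite left_coset_comp !(left_cosetE x) -set_mulA; congr (set_mul _ _).
(* S (y S) = S (S y) = S y = y S *)
rewrite nS // right_cosetE set_mulA (set_mul_absorb gS) //.
exact: is_group_unit gS.
Qed.

Lemma quotient_group S K e : is_normal_subgroup S K e ->
  is_group (@set_mul G) (cosets K S) S.
Proof.
move=> nSK; have [[gK gS SK] nS] := nSK; have Se := is_group_unit gS.
split.
- move=> _ _ [x Kx <-] [y Ky <-]; exists (x * y); first exact: (is_group_op gK).
  by rewrite (left_coset_mul _ nSK).
- by move=> X Y Z _ _ _; rewrite set_mulA.
- by exists e; [exact: is_group_unit gK | exact: left_coset_absorb gS Se].
- move=> _ [x Kx <-]; split.
    by rewrite nS // right_cosetE set_mulA (set_mul_absorb gS).
  by rewrite left_cosetE -set_mulA (set_mul_absorb gS).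
- move=> _ [x Kx <-]; have [y Ky [xy yx]] := is_group_inv gK Kx.
  exists (left_coset y S); first by exists y.
  rewrite !(left_coset_mul _ nSK) // xy yx.
  by split; exact: left_coset_absorb gS Se.
Qed.

(** * The second isomorphism theorem *)

(** If [x n = m x] with [x, n] in [H], then [m = x n x^-1] is also in [H]; this
is why the normality relation of [N] restricts to [N `&` H]. *)
Lemma normal_capr N K H e : is_normal_subgroup N K e -> is_subgroup H K e ->
  is_normal_subgroup (N `&` H) H e.
Proof.
move=> [[gK gN NK] nN] [_ gH HK].
(* an inverse taken in H coincides with the one taken in N *)
have inv_cap x y : H x -> N x -> H y -> x * y = e -> N y.
  move=> Hx Nx Hy xy; have [z Nz [_ zx]] := is_group_inv gN Nx.
  suff -> : y = z by [].
  have [<- _] := is_group_op1 gH Hy; rewrite -zx -mulgA xy.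
  by case: (is_group_op1 gN Nz).
split.
  split=> //.
  split.
  - move=> x y [Nx Hx] [Ny Hy]; split.
      exact: (is_group_op gN).
    exact: (is_group_op gH).
  - by move=> x y z _ _ _; rewrite mulgA.
  - by split; [exact: is_group_unit gN | exact: is_group_unit gH].
  - by move=> x [Nx _]; exact: (is_group_op1 gN).
  - move=> x [Nx Hx]; have [y Hy [xy yx]] := is_group_inv gH Hx.
    by exists y => //; split=> //; exact: inv_cap xy.
move=> x Hx; have Kx := HK _ Hx.
have [y Hy [xy yx]] := is_group_inv gH Hx.
apply/seteqP; split=> _ [n [Nn Hn] <-].
  have : right_coset N x (x * n) by rewrite -nN //; exists n.
  case=> m Nm mx; exists m => //; split=> //.
  have [_ <-] := is_group_op1 gN Nm; rewrite -xy mulgA mx.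
  by do 2?apply: (is_group_op gH).
have : left_coset x N (n * x) by rewrite nN //; exists n.
case=> m Nm xm; exists m => //; split=> //.
have [<- _] := is_group_op1 gN Nm; rewrite -yx -mulgA xm.
by do 2?apply: (is_group_op gH).
Qed.

(** Normality moves the elements of [H] past those of [N]:
[n h n' h' = n (h n' h^-1) h h'] and [(n h)^-1 = (h^-1 n^-1 h) h^-1]. *)
Lemma set_mul_subgroup N K H e : is_normal_subgroup N K e ->
  is_subgroup H K e -> is_subgroup (set_mul N H) K e.
Proof.
move=> [[gK gN NK] nN] [_ gH HK].
have swap h n : H h -> N n -> exists2 m, N m & h * n = m * h.
  move=> Hh Nn; have : right_coset N h (h * n).
    by rewrite -nN; [exists n | exact: HK].
  by case=> m Nm mh; exists m.
have NHK : set_mul N H `<=` K.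
  by move=> _ [n Nn [h Hh <-]]; apply: (is_group_op gK); [exact: NK|exact: HK].
split=> //; split.
- move=> _ _ [n Nn [h Hh <-]] [n' Nn' [h' Hh' <-]].
  have [m Nm hm] := swap _ _ Hh Nn'.
  exists (n * m); first exact: (is_group_op gN).
  exists (h * h'); first exact: (is_group_op gH).
  by rewrite !mulgA; congr (_ * _); rewrite -!mulgA hm.
- by move=> x y z _ _ _; rewrite mulgA.
- exists e; first exact: is_group_unit gN.
  exists e; first exact: is_group_unit gH.
  by case: (is_group_op1 gK (is_group_unit gK)).
- by move=> x /NHK; exact: (is_group_op1 gK).
- move=> _ [n Nn [h Hh <-]].
  have [n' Nn' [nn' n'n]] := is_group_inv gN Nn.
  have [h' Hh' [hh' h'h]] := is_group_inv gH Hh.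
  exists (h' * n').
    by have [m Nm ->] := swap _ _ Hh' Nn'; exists m => //; exists h'.
  split.
    rewrite mulgA -(mulgA n) hh'.
    by have [_ ->] := is_group_op1 gN Nn.
  rewrite mulgA -(mulgA h') n'n.
  by have [_ ->] := is_group_op1 gH Hh'.
Qed.

Lemma normal_in_set_mul N K H e : is_normal_subgroup N K e ->
  is_subgroup H K e -> is_normal_subgroup N (set_mul N H) e.
Proof.
move=> nNK hH; have [_ gNH NHK] := set_mul_subgroup nNK hH.
have [[gK gN NK] nN] := nNK; have [_ gH _] := hH.
split; last by move=> x /NHK; exact: nN.
split=> // n Nn; exists n => //; exists e; first exact: is_group_unit gH.
by case: (is_group_op1 gN Nn).
Qed.

Lemma set_mul_coset_cap N K H e h : is_normal_subgroup N K e ->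
  is_subgroup H K e -> set_mul (left_coset h (N `&` H)) N = left_coset h N.
Proof.
move=> [[_ gN _] _] [_ gH _]; rewrite !left_cosetE -set_mulA.
rewrite (set_mul_absorb gN) //.
by split; [exact: is_group_unit gN | exact: is_group_unit gH].
Qed.

(** Taking [C |-> C N] as the map avoids any choice of coset representatives,
so well-definedness costs nothing. *)
Lemma second_isomorphism N K H e : is_normal_subgroup N K e ->
  is_subgroup H K e ->
  is_group_iso (@set_mul G) (cosets H (N `&` H)) (N `&` H)
    (@set_mul G) (cosets (set_mul N H) N) N (fun C => set_mul C N).
Proof.
move=> nNK hH; have nDH := normal_capr nNK hH.
have nNNH := normal_in_set_mul nNK hH; have piE h := set_mul_coset_cap h nNK hH.
have [[_ gD _] _] := nDH; have [[gK gN NK] nN] := nNK; have [_ gH HK] := hH.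
split; [exact: quotient_group nDH | exact: quotient_group nNNH | split |].
- move=> _ [h Hh <-]; rewrite piE; exists h => //.
  exists e; first exact: is_group_unit gN.
  by exists h => //; case: (is_group_op1 gH Hh).
- move=> _ _ /set_mem[h Hh <-] /set_mem[k Hk <-]; rewrite !piE => hk.
  have : left_coset k N h.
    rewrite -hk; exists e; first exact: is_group_unit gN.
    by case: (is_group_op1 gH Hh).
  (* h = k n with n = k^-1 h in H, so both cosets of N `&` H agree *)
  move=> [n Nn kn]; rewrite -kn left_coset_comp.
  rewrite (left_coset_absorb gD) //; split=> //.
  have [k' Hk' [_ k'k]] := is_group_inv gH Hk.
  have [<- _] := is_group_op1 gN Nn; rewrite -k'k -mulgA kn.
  exact: (is_group_op gH).
- move=> _ [_ [n Nn [h Hh <-]] <-].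
  exists (left_coset h (N `&` H)); first by exists h.
  (* n h N = n N h = N h *)
  rewrite piE left_coset_comp nN; last exact: HK.
  rewrite left_cosetE right_cosetE set_mulA -left_cosetE.
  by rewrite (left_coset_absorb gN).
- move=> _ _ [h Hh <-] [k Hk <-].
  rewrite (left_coset_mul _ nDH) // !piE (left_coset_mul _ nNK) //.
  exact: HK.
Qed.

End SetProducts.

(** * Component groups of a hyper group *)

Section Components.
Variables (d : Order.disp_t) (L : latticeType d) (G : semigroupType).
Variable ix : L -> G.
Implicit Types (A E : set G) (e x y : G).

Lemma identity_of_mull A E x e : is_identity_set ix A E ->
  identity_of ix E x e -> e * x = x.
Proof. by move=> hE [Ee [l le /(_ l)]]; rewrite le => /(_ Ee)[_ ->]. Qed.

(** The right inverse turns [e_k * x = x] into [e_k * e = e], which only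
concerns the index lattice; the condition obtained is the same whatever
identity set [k] ranges over. *)
Lemma component_of_invertible A E e x y : is_identity_set ix A E ->
  A x -> E e -> e * x = x -> x * y = e -> component ix A E e x.
Proof.
move=> hE Ax Ee ex xy; split=> //; split=> //.
have [l _ le] := (identity_set_lattice hE).1 _ Ee; exists l => // k Ek.
have El : E (ix l) by rewrite le.
have [Ekl _] := (identity_set_lattice hE).2 _ _ Ek El.
have kl := identity_set_join hE Ek El.
split=> [kx|lekl].
  rewrite -eq_joinr; apply/eqP; apply: (identity_set_inj hE) => //.
  by rewrite -kl le -xy mulgA kx.
rewrite -{1}ex -le mulgA kl.
by move: lekl; rewrite -eq_joinr => /eqP ->; rewrite le.
Qed.

(** The inverse provided by the axioms may lie in another component; its
product with [e] is the inverse inside the component of [e]. *)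
Lemma component_inv A E e x : is_hyper_group_on ix A E ->
  component ix A E e x ->
  exists2 y, component ix A E e y & x * y = e /\ y * x = e.
Proof.
move=> hA [Ax ix_x]; have hE := hyper_group_ids hA; have [Ee _] := ix_x.
have ex := identity_of_mull hE ix_x; have Ae := identity_set_sub hE Ee.
have xe : x * e = x by rewrite (identity_set_comm hE).
have [z Az /(_ _ ix_x)[xz zx]] := hyper_group_inv hA Ax.
have ee : e * e = e by rewrite -{2}xz mulgA ex xz.
have yx : e * z * x = e by rewrite -mulgA zx ee.
exists (e * z); last by rewrite mulgA xe.
apply: (component_of_invertible hE _ Ee _ yx); last by rewrite mulgA ee.
exact: (hyper_group_mul hA).
Qed.

Lemma component_group A E e : is_hyper_group_on ix A E -> E e ->
  is_group *%g (component ix A E e) e.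
Proof.
move=> hA Ee; have hE := hyper_group_ids hA; have Ae := identity_set_sub hE Ee.
have ee : e * e = e.
  have [l _ le] := (identity_set_lattice hE).1 _ Ee.
  by rewrite -le (identity_set_join hE) ?le // joinxx.
have ce x : component ix A E e x -> e * x = x /\ x * e = x.
  move=> [Ax ix_x]; have ex := identity_of_mull hE ix_x.
  by split; rewrite // (identity_set_comm hE).
split=> //.
- move=> x y cx cy; have [x' _ [xx' _]] := component_inv hA cx.
  have [y' _ [yy' _]] := component_inv hA cy.
  apply: (component_of_invertible hE (y := y' * x')) => //.
  + by apply: (hyper_group_mul hA); [case: cx | case: cy].
  + by rewrite mulgA (ce x cx).1.
  + by rewrite mulgA -(mulgA x) yy' (ce x cx).2.
- by move=> x y z _ _ _; rewrite mulgA.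
- exact: (component_of_invertible hE _ Ee ee ee).
- by move=> x; exact: component_inv.
Qed.

(** The identity of an element of a sub hyper group is the same in the ambient
hyper group, by [component_of_invertible]. *)
Lemma component_subgroup A E e : is_hyper_group ix ->
  is_sub_hyper_group ix A E -> E e ->
  is_subgroup (component ix A E e) (component ix setT (range ix) e) e.
Proof.
move=> hG hA Ee; have hE := hyper_group_ids hA.
have Re : range ix e by exact: (identity_set_lattice hE).1.
split; [exact: (component_group hG Re) | exact: component_group | move=> x cx].
have [y _ [xy _]] := component_inv hA cx.
apply: (component_of_invertible (hyper_group_ids hG) _ Re _ xy) => //.
by case: cx => _; exact: identity_of_mull hE.
Qed.

Lemma component_normal A E e : is_hyper_group ix ->
  is_normal_sub_hyper_group ix A E -> E e ->
  is_normal_subgroup (component ix A E e) (component ix setT (range ix) e) e.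
Proof.
move=> hG [hA nA] Ee; split; first exact: component_subgroup.
by move=> x [_ ix_x]; exact: nA.
Qed.

End Components.

(** * The isomorphism theorem for hyper groups *)

Theorem theorem5p8 (d : Order.disp_t) (L : latticeType d) (G : semigroupType)
    (ix : L -> G) (H eH N eN : set G)
    (hG : is_hyper_group ix)
    (hH : is_sub_hyper_group ix H eH)
    (hN : is_normal_sub_hyper_group ix N eN)
    (e : G) (he : (eH `&` eN) e) :
  let Ge := component ix setT (range ix) e in
  let He := component ix H eH e in
  let Ne := component ix N eN e in
  let NHe := set_mul Ne He in
  [/\ is_normal_subgroup (Ne `&` He) He e,
      is_subgroup NHe Ge e
    & is_normal_subgroup Ne NHe e /\
      exists pi : set G -> set G,
        (forall h, He h -> pi (left_coset h (Ne `&` He)) = left_coset h Ne) /\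
        is_group_iso (@set_mul G) (cosets He (Ne `&` He)) (Ne `&` He)
                     (@set_mul G) (cosets NHe Ne) Ne pi].
Proof.
case: he => eHe eNe.
have sH := component_subgroup hG hH eHe; have nN := component_normal hG hN eNe.
move=> Ge He Ne NHe; split.
- exact: normal_capr nN sH.
- exact: set_mul_subgroup nN sH.
- split; first exact: normal_in_set_mul nN sH.
  exists (fun C => set_mul C Ne); split; last exact: second_isomorphism nN sH.
  by move=> h _; exact: set_mul_coset_cap nN sH.
Qed.
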